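(* Any $3\times 3$ matrix $A$ with entries in the quaternions $\mathbb{H}$ has at least one left eigenvalue.
   Context: A quaternion $\lambda\in\mathbb{H}$ is a left eigenvalue of a square quaternionic matrix $A$ if the matrix $A-\lambda\,\mathrm{Id}$ is not invertible. *)

(* Defs.v *)
From HB Require Import structures.
From mathcomp Require Import all_boot all_order all_algebra.
From mathcomp Require Import ring.
From mathcomp Require Import reals.

Set Implicit Arguments.
Unset Strict Implicit.
Unset Printing Implicit Defensive.

Import Order.TTheory GRing.Theory Num.Theory.
Local Open Scope ring_scope.

(* [Quat a b c d] stands for a + b i + c j + d k. *)
Record quaternion (R : Type) : Type :=
  Quat { qre : R; qi : R; qj : R; qk : R }.

Section QuaternionChoice.
Variable R : Type.

Definition seq_of_quat (x : quaternion R) : seq R :=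
  let: Quat a b c d := x in [:: a; b; c; d].

Definition quat_of_seq (s : seq R) : option (quaternion R) :=
  if s is [:: a; b; c; d] then Some (Quat a b c d) else None.

Lemma seq_of_quatK : pcancel seq_of_quat quat_of_seq.
Proof. by case. Qed.

End QuaternionChoice.

HB.instance Definition _ (R : eqType) := Equality.copy (quaternion R)
  (pcan_type (@seq_of_quatK R)).
HB.instance Definition _ (R : choiceType) := Choice.copy (quaternion R)
  (pcan_type (@seq_of_quatK R)).

Section QuaternionRing.
Variable R : comNzRingType.
Implicit Types x y z : quaternion R.

Definition addq x y : quaternion R :=
  let: Quat a b c d := x in let: Quat a' b' c' d' := y in
  Quat (a + a') (b + b') (c + c') (d + d').

Definition oppq x : quaternion R :=
  let: Quat a b c d := x in Quat (- a) (- b) (- c) (- d).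

Definition mulq x y : quaternion R :=
  let: Quat a b c d := x in let: Quat a' b' c' d' := y in
  Quat (a * a' - b * b' - c * c' - d * d')
       (a * b' + b * a' + c * d' - d * c')
       (a * c' - b * d' + c * a' + d * b')
       (a * d' + b * c' - c * b' + d * a').

Lemma addqA : associative addq.
Proof. by move=> [? ? ? ?] [? ? ? ?] [? ? ? ?] /=; rewrite !addrA. Qed.

Lemma addqC : commutative addq.
Proof. by move=> [? ? ? ?] [? ? ? ?] /=; congr Quat; rewrite addrC. Qed.

Lemma add0q : left_id (Quat 0 0 0 0) addq.
Proof. by move=> [? ? ? ?] /=; rewrite !add0r. Qed.

Lemma addNq : left_inverse (Quat 0 0 0 0) oppq addq.
Proof. by move=> [? ? ? ?] /=; rewrite !addNr. Qed.

HB.instance Definition _ :=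
  GRing.isZmodule.Build (quaternion R) addqA addqC add0q addNq.

Lemma mulqA : associative mulq.
Proof. by move=> [? ? ? ?] [? ? ? ?] [? ? ? ?] /=; congr Quat; ring. Qed.

Lemma mul1q : left_id (Quat 1 0 0 0) mulq.
Proof. by move=> [? ? ? ?] /=; congr Quat; ring. Qed.

Lemma mulq1 : right_id (Quat 1 0 0 0) mulq.
Proof. by move=> [? ? ? ?] /=; congr Quat; ring. Qed.

Lemma mulqDl : left_distributive mulq addq.
Proof. by move=> [? ? ? ?] [? ? ? ?] [? ? ? ?] /=; congr Quat; ring. Qed.

Lemma mulqDr : right_distributive mulq addq.
Proof. by move=> [? ? ? ?] [? ? ? ?] [? ? ? ?] /=; congr Quat; ring. Qed.

Lemma oneq_neq0 : Quat 1 0 0 0 != 0 :> quaternion R.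
Proof. by apply/eqP => -[] /eqP; rewrite oner_eq0. Qed.

HB.instance Definition _ := GRing.Zmodule_isNzRing.Build (quaternion R)
  mulqA mul1q mulq1 mulqDl mulqDr oneq_neq0.

Lemma quaternion_table (i := Quat 0 1 0 0 : quaternion R)
    (j := Quat 0 0 1 0 : quaternion R) (k := Quat 0 0 0 1 : quaternion R) :
  [/\ i * i = -1, j * j = -1, k * k = -1 &
   [/\ i * j = k, j * k = i, k * i = j &
   [/\ j * i = - k, k * j = - i & i * k = - j]]].
Proof. by do !split; congr Quat; ring. Qed.

End QuaternionRing.

Section QuaternionDivision.
Variable R : realFieldType.
Implicit Types x y : quaternion R.

Definition normsq x : R :=
  let: Quat a b c d := x in a ^+ 2 + b ^+ 2 + c ^+ 2 + d ^+ 2.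

Definition invq x : quaternion R :=
  let: Quat a b c d := x in let n := normsq x in
  Quat (a / n) (- b / n) (- c / n) (- d / n).

Lemma normsq_neq0 x : x != 0 -> normsq x != 0.
Proof.
case: x => a b c d; apply: contraNN => /=.
rewrite !paddr_eq0 ?addr_ge0 ?sqr_ge0 // !sqrf_eq0.
by move=> /andP[/andP[/andP[/eqP-> /eqP->] /eqP->] /eqP->].
Qed.

Lemma mulVq : {in [pred x | x != 0], left_inverse 1 invq *%R}.
Proof.
move=> x; rewrite inE => /normsq_neq0.
by case: x => a b c d /= n0; congr Quat; field.
Qed.

Lemma mulqV : {in [pred x | x != 0], right_inverse 1 invq *%R}.
Proof.
move=> x; rewrite inE => /normsq_neq0.
by case: x => a b c d /= n0; congr Quat; field.
Qed.

Lemma unitqP x y : y * x = 1 /\ x * y = 1 -> x != 0.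
Proof.
by move=> [+ _]; apply: contra_eqN => /eqP->; rewrite mulr0 eq_sym oner_eq0.
Qed.

Lemma invq_out : {in [predC [pred x | x != 0]], invq =1 id}.
Proof.
move=> x; rewrite inE /= negbK => /eqP->.
by congr Quat; rewrite ?oppr0 mul0r.
Qed.

HB.instance Definition _ := GRing.NzRing_hasMulInverse.Build (quaternion R)
  mulVq mulqV unitqP invq_out.

End QuaternionDivision.

(* [unitmx] requires commutative coefficients, hence the explicit two-sided
   inverse. *)
Definition invertible_mx (S : pzRingType) (n : nat) (A : 'M[S]_n) : Prop :=
  exists B : 'M[S]_n, A *m B = 1%:M /\ B *m A = 1%:M.

Definition left_eigenvalue (S : pzRingType) (n : nat) (A : 'M[S]_n)
    (lambda : S) : Prop :=
  ~ invertible_mx (A - lambda%:M).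

(* Main.v *)
Require Import Defs.
From mathcomp Require Import all_boot all_order all_algebra.
From mathcomp Require Import reals.
From mathcomp Require Import ring lra zify.
From mathcomp Require Import boolp classical_sets functions.
From mathcomp Require Import topology normedtype sequences.

Set Implicit Arguments.
Unset Strict Implicit.
Unset Printing Implicit Defensive.

(** Let the rows of [A] be [(a, b, c)], [(d, e, f)], [(g, h, k)].  If
    [b = c = 0], the first row of [A - a] vanishes and [a] is a left eigenvalue.
    Otherwise the indices 2 and 3 may be exchanged so that [c] is nonzero, and
    the first row of [A v = lambda v], with first coordinate 1, determines the
    third coordinate of [v].  After a translation [lambda = gam + w] two
    equations remain ([pivot_eigenvector]):

      [w y = e0 + e1 w] and
      [(g0 + g1 w - w g2 - w p w) + (s + w eps) y = 0],

    where [p = c^-1].  If [s = 0], then [gam] is an eigenvalue.  If not,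
    eliminating [y] and multiplying by [w s^-1] on the left leaves one equation
    with leading term [- w s^-1 w p w], of degree 3 in [w], and one
    non-polynomial term, [w s^-1 w eps w^-1 (e0 + e1 w)].  The substitution
    [w = |x|^2 x] turns the equation into a polynomial one: the leading term
    becomes an odd map of degree 9 in [x] whose norm is a constant multiple of
    [|x|^9], and everything else has degree at most 6
    ([quadratic_pair_zero]).

    A zero exists because 3 is odd: the lower terms can be switched off far from
    the origin, which makes the map odd there, and a continuous self-map of
    [R^n] that is odd outside a ball vanishes somewhere
    ([odd_at_infinity_zero]).  This form of the Borsuk-Ulam theorem comes from a
    combinatorial lemma of Tucker and Ky Fan ([tucker]).  A point where the map
    does not vanish is labelled by the index and the sign of a largest
    coordinate of its image.  On a fine enough subdivision of a cross-polytope
    no simplex has two opposite labels.  Counting modulo 2 the simplices with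
    alternating labels, the count of the subdivided sphere of each dimension
    equals that of the sphere one dimension lower, hence is 1; on the top sphere
    it is also the count on the boundary of a ball whose simplices have more
    vertices than there are label indices, hence is 0. *)

(** * Chains modulo 2 and iterated subdivision *)

(** Simplices are ordered lists of vertices.  The boundary is augmented: the
    faces of a single point are the empty simplex, so that the identity
    [eval_boundary_cone] has no exceptional case in low dimension. *)
Fixpoint faces (T : Type) (s : seq T) : seq (seq T) :=
  if s is x :: s' then s' :: [seq x :: t | t <- faces s'] else [::].

Lemma faces_map (T T' : Type) (g : T -> T') s :
  faces (map g s) = [seq map g t | t <- faces s].
Proof. by elim: s => //= x s ->; rewrite -!map_comp. Qed.

(** Chains are lists of simplices, meant modulo 2: two chains count as equal when
    every cochain [phi] takes the same value on both.  Identities between chains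
    are therefore stated after [eval phi]. *)
Definition eval (T : Type) (phi : seq T -> bool) (c : seq (seq T)) : bool :=
  \big[addb/false]_(s <- c) phi s.

Lemma eval_map (T T' : Type) phi (f : seq T -> seq T') c :
  eval phi [seq f s | s <- c] = eval (phi \o f) c.
Proof. by rewrite /eval big_map. Qed.

Section Chains.
Variable T : eqType.
Implicit Types (s t : seq T) (c : seq (seq T)) (phi : seq T -> bool).

Definition boundary c := flatten [seq faces s | s <- c].

Definition cone x c := [seq x :: s | s <- c].

Lemma eval_nil phi : eval phi [::] = false.
Proof. by rewrite /eval big_nil. Qed.

Lemma eval_cons phi s c : eval phi (s :: c) = phi s (+) eval phi c.
Proof. by rewrite /eval big_cons. Qed.

Lemma eval_cat phi c1 c2 : eval phi (c1 ++ c2) = eval phi c1 (+) eval phi c2.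
Proof. by rewrite /eval big_cat. Qed.

Lemma eval_flatten phi (F : seq T -> seq (seq T)) c :
  eval phi (flatten [seq F s | s <- c]) = eval (fun s => eval phi (F s)) c.
Proof. by rewrite /eval big_flatten big_map. Qed.

Lemma eq_eval phi psi c : {in c, phi =1 psi} -> eval phi c = eval psi c.
Proof. by move=> eq_pp; rewrite /eval; apply: eq_big_seq. Qed.

Lemma eval_addb phi psi c :
  eval (fun s => phi s (+) psi s) c = eval phi c (+) eval psi c.
Proof. by rewrite /eval big_split. Qed.

Lemma eval_pred0 c : eval (fun=> false) c = false.
Proof. by rewrite /eval big1_eq. Qed.

Lemma eval_faces_cons phi x s :
  eval phi (faces (x :: s)) = phi s (+) eval (phi \o cons x) (faces s).
Proof. by rewrite /= eval_cons eval_map. Qed.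

Lemma eval_boundary_cone phi x c :
  eval phi (boundary (cone x c))
    = eval phi c (+) eval phi (cone x (boundary c)).
Proof.
rewrite eval_flatten !eval_map eval_flatten -eval_addb.
by apply: eq_eval => s _; rewrite /= eval_cons eval_map.
Qed.

(** The boundary of a boundary is zero: a simplex is the cone from its first
    vertex over the opposite face, so induction and [eval_boundary_cone]
    suffice. *)
Lemma eval_boundary_faces phi s : eval phi (boundary (faces s)) = false.
Proof.
elim: s phi => [|x s IHs] phi; first by rewrite eval_nil.
rewrite /boundary /= eval_cat -/(cone x (faces s)) -/(boundary _).
rewrite eval_boundary_cone.
by rewrite eval_map IHs addbF addbb.
Qed.

Lemma size_faces s t : t \in faces s -> size s = (size t).+1.
Proof.
elim: s t => [|x s IHs] t //=; rewrite inE => /predU1P[-> // | /mapP[u us ->]].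
by rewrite (IHs u us).
Qed.

Lemma mem_faces s t : t \in faces s -> {subset t <= s}.
Proof.
elim: s t => [|x s IHs] t //=; rewrite inE => /predU1P[-> | /mapP[u us ->]] y.
  by rewrite inE => ->; rewrite orbT.
by rewrite !inE => /predU1P[->|/(IHs u us)->]; rewrite ?eqxx ?orbT.
Qed.

Section Subdivision.
Variable apex : seq T -> T.

(** Barycentric subdivision: the subdivided boundary is coned from [apex s].  The
    counter [n] stands for [size s], because faces are not subterms.  The
    combinatorial statements hold for any choice of [apex]. *)
Fixpoint subdivide_rec n s : seq (seq T) :=
  if (n, s) is (n'.+1, _ :: _)
  then cone (apex s) (flatten [seq subdivide_rec n' t | t <- faces s])
  else [:: [::]].

Definition subdivide s := subdivide_rec (size s) s.

Definition subdiv_chain c := flatten [seq subdivide s | s <- c].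

Lemma subdivide_nil : subdivide [::] = [:: [::]]. Proof. by []. Qed.

Lemma subdivide_cons x s :
  subdivide (x :: s) = cone (apex (x :: s)) (subdiv_chain (faces (x :: s))).
Proof.
rewrite /subdiv_chain; suff /eq_in_map-> :
  {in faces (x :: s), subdivide =1 subdivide_rec (size s)} by [].
by move=> t /size_faces[]; rewrite /subdivide => ->.
Qed.

Lemma faces_ind (P : seq T -> Prop) :
  P [::] -> (forall s, s != [::] -> {in faces s, forall t, P t} -> P s) ->
  forall s, P s.
Proof.
move=> P0 PS s; have [n] := ubnP (size s); elim: n s => // n IHn [|x s] // lt_s_n.
apply: PS => // t /size_faces size_t; apply: IHn.
by rewrite size_t ltnS in lt_s_n.
Qed.

(** Subdivision is a chain map.  The boundary of the cone over the subdivided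
    boundary is that subdivided boundary plus the cone over its own boundary,
    and the latter vanishes by induction. *)
Lemma eval_boundary_subdivide phi s :
  eval phi (boundary (subdivide s)) = eval phi (subdiv_chain (faces s)).
Proof.
elim/faces_ind: s phi => [|[|x s] // _ IHs] phi.
  by rewrite subdivide_nil eval_nil.
rewrite subdivide_cons eval_boundary_cone -[RHS]addbF; congr (_ (+) _).
rewrite eval_map eval_flatten eval_flatten.
pose psi t := eval (phi \o cons (apex (x :: s))) (subdivide t).
rewrite -(eval_boundary_faces psi (x :: s)).
rewrite eval_flatten; apply: eq_eval => t ts; rewrite -!eval_flatten.
exact: IHs.
Qed.

Lemma eval_boundary_subdiv_chain phi c :
  eval phi (boundary (subdiv_chain c)) = eval phi (subdiv_chain (boundary c)).
Proof.
rewrite eval_flatten eval_flatten [RHS]eval_flatten eval_flatten.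
apply: eq_eval => s _; rewrite -!eval_flatten -/(boundary _).
exact: eval_boundary_subdivide.
Qed.

Lemma eval_subdiv_chain phi c :
  eval phi (subdiv_chain c) = eval (fun s => eval phi (subdivide s)) c.
Proof. exact: eval_flatten. Qed.

Lemma eval_boundary_iter_subdiv phi n c :
  eval phi (boundary (iter n subdiv_chain c))
    = eval phi (iter n subdiv_chain (boundary c)).
Proof.
elim: n phi => [//|n IHn] phi; rewrite !iterS eval_boundary_subdiv_chain.
by rewrite [LHS]eval_flatten [RHS]eval_flatten IHn.
Qed.

Lemma eq_eval_iter_subdiv n c1 c2 :
  (forall phi, eval phi c1 = eval phi c2) ->
  forall phi,
    eval phi (iter n subdiv_chain c1) = eval phi (iter n subdiv_chain c2).
Proof. by move=> eq_c; elim: n => //= n IHn phi; rewrite !eval_subdiv_chain. Qed.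

Lemma iter_subdiv_cat n c1 c2 :
  iter n subdiv_chain (c1 ++ c2) = iter n subdiv_chain c1 ++ iter n subdiv_chain c2.
Proof.
by elim: n => //= n ->; rewrite /subdiv_chain map_cat flatten_cat.
Qed.

Lemma iter_subdiv_nil n : iter n subdiv_chain [:: [::]] = [:: [::]].
Proof. by elim: n => //= n ->. Qed.

Lemma mem_subdiv_chain c t :
  reflect (exists2 s, s \in c & t \in subdivide s) (t \in subdiv_chain c).
Proof.
apply: (iffP flatten_mapP) => -[s cs ts]; by exists s.
Qed.

Lemma size_subdivide s t : t \in subdivide s -> size t = size s.
Proof.
elim/faces_ind: s t => [|[|x s] // _ IHs] t; first by rewrite inE => /eqP->.
rewrite subdivide_cons => /mapP[u /mem_subdiv_chain[f fs uf] ->].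
by rewrite [LHS]/= (IHs f fs u uf) (size_faces fs).
Qed.

Lemma subdivide_hull (Q : T -> Prop) :
  (forall s, s != [::] -> {in s, forall x, Q x} -> Q (apex s)) ->
  forall s, {in s, forall x, Q x} ->
  forall t, t \in subdivide s -> {in t, forall x, Q x}.
Proof.
move=> Qapex; elim/faces_ind => [|[|x s] // s0 IHs] Qs t.
  by rewrite inE => /eqP->.
rewrite subdivide_cons => /mapP[u /mem_subdiv_chain[f fs uf] ->] y.
rewrite inE => /predU1P[->|]; first exact: Qapex.
by apply: IHs uf y => // y yf; apply: Qs; apply: (mem_faces fs).
Qed.

(** A predicate closed under [apex] propagates from a simplex of [c] to all the
    simplices of its subdivisions.  The source simplex [s] is chosen before [Q],
    because [Q] often depends on it, as when [Q] defines the hyperplane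
    of [s]. *)
Lemma iter_subdiv_hull n c t : t \in iter n subdiv_chain c ->
  exists2 s, s \in c & forall Q : T -> Prop,
    (forall u, u != [::] -> {in u, forall x, Q x} -> Q (apex u)) ->
    {in s, forall x, Q x} -> {in t, forall x, Q x}.
Proof.
elim: n t => [|n IHn] t /=; first by move=> ct; exists t.
move=> /mem_subdiv_chain[u /IHn[s cs Qsu] tu]; exists s => // Q Qapex Qs.
by apply: (subdivide_hull Qapex _ tu); apply: Qsu.
Qed.

Lemma size_iter_subdiv n c t : t \in iter n subdiv_chain c ->
  exists2 s, s \in c & size t = size s.
Proof.
elim: n t => [|n IHn] t /=; first by move=> ct; exists t.
move=> /mem_subdiv_chain[u /IHn[s cs size_u] /size_subdivide size_t].
by exists s; rewrite // size_t.
Qed.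

Section Equivariance.
Variable g : T -> T.
Hypothesis apex_map : forall s, s != [::] -> apex (map g s) = g (apex s).

Lemma subdivide_map s : subdivide (map g s) = [seq map g t | t <- subdivide s].
Proof.
elim/faces_ind: s => [|[|x s] // s0 IHs] //.
rewrite map_cons subdivide_cons -map_cons apex_map // subdivide_cons.
suff -> : subdiv_chain (faces (map g (x :: s)))
    = [seq map g t | t <- subdiv_chain (faces (x :: s))] by rewrite /cone -!map_comp.
rewrite /subdiv_chain faces_map map_flatten -!map_comp; congr (flatten _).
exact/eq_in_map.
Qed.

Lemma iter_subdiv_map n c :
  iter n subdiv_chain [seq map g s | s <- c]
    = [seq map g s | s <- iter n subdiv_chain c].
Proof.
elim: n => //= n ->; rewrite /subdiv_chain map_flatten -!map_comp; congr (flatten _).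
by apply: eq_map => s /=; rewrite subdivide_map.
Qed.

End Equivariance.
End Subdivision.
End Chains.

(** * Counting alternating labels *)
Section Alternating.

Definition label := (nat * bool)%type.
Implicit Types (l : seq label) (x y : label).

Definition opp_label x : label := (x.1, ~~ x.2).

Fixpoint insert x l :=
  if l is y :: l' then if x.1 <= y.1 then x :: l else y :: insert x l'
  else [:: x].

Definition isort l := foldr insert [::] l.

Definition idx_le x y := x.1 <= y.1.

Fixpoint alternates b l :=
  if l is x :: l' then
    [&& x.2 == b, all (fun y => x.1 < y.1) l' & alternates (~~ b) l']
  else true.

(** The vertices of a subdivided simplex carry labels in no particular order,
    hence the sorting. *)
Definition alternating l := alternates false (isort l).

Lemma insert_perm x l : perm_eq (insert x l) (x :: l).
Proof.
elim: l => //= y l IHl; case: ifP => // _.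
rewrite -(perm_cons y) in IHl; apply: perm_trans IHl _.
by rewrite (perm_catCA [:: y] [:: x] l).
Qed.

Lemma isort_perm l : perm_eq (isort l) l.
Proof.
elim: l => //= x l IHl; apply: perm_trans (insert_perm _ _) _.
by rewrite perm_cons.
Qed.

Definition idx_sorted l := pairwise idx_le l.

Lemma insert_sorted x l : idx_sorted l -> idx_sorted (insert x l).
Proof.
rewrite /idx_sorted; elim: l => //= y l IHl /andP[yl sl].
case: leqP => [xy|yx] /=.
  rewrite yl sl !andbT [idx_le x y]xy; apply: sub_all yl => z; exact: leq_trans.
rewrite IHl // andbT (perm_all _ (insert_perm x l)) /= yl andbT; exact: ltnW.
Qed.

Lemma isort_sorted l : idx_sorted (isort l).
Proof. by elim: l => //= x l; apply: insert_sorted. Qed.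

Lemma insert_min x l : all (idx_le x) l -> insert x l = x :: l.
Proof. by case: l => //= y l /andP[+ _]; rewrite /idx_le => ->. Qed.

(** Removing one element commutes with inserting [x], up to the order of the
    resulting lists; the additional face [l] comes from removing [x]. *)
Lemma eval_faces_insert phi x l : idx_sorted l ->
  eval phi (faces (insert x l)) = phi l (+) eval (phi \o insert x) (faces l).
Proof.
rewrite /idx_sorted; elim: l phi => [|y l IHl] phi.
  by rewrite /= eval_cons !eval_nil.
move=> /andP[yl sl]; rewrite [insert x _]/=; case: leqP => [xy|yx].
  rewrite eval_faces_cons.
  congr (_ (+) _); apply: eq_eval => t ty /=.
  rewrite insert_min //; apply/allP => z /(mem_faces ty).
  by rewrite inE => /predU1P[-> //|/(allP yl)]; apply: leq_trans.
rewrite !eval_faces_cons IHl // addbCA; congr (_ (+) (_ (+) _)).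
by apply: eq_eval => t _ /=; rewrite leqNgt yx.
Qed.

Lemma eval_faces_isort phi l :
  eval (phi \o isort) (faces l) = eval phi (faces (isort l)).
Proof.
elim: l phi => [|x l IHl] phi; first by rewrite /= !eval_nil.
by rewrite eval_faces_cons [isort _]/= eval_faces_insert ?isort_sorted // -IHl.
Qed.

Definition noncomplementary l := {in l &, forall x y, x.1 = y.1 -> x.2 = y.2}.

(** For strictly increasing indices: if the signs of [l] alternate, a face that
    alternates again omits an end of [l], the last element if the initial sign is
    to be kept, the first one if it is to be changed.  If they do not, alternating
    faces come in pairs, from deleting either of two neighbours of equal sign.
    Equal indices carry equal signs by hypothesis, and then the deletions of the
    two equal labels cancel. *)
Lemma eval_faces_alternates b l : idx_sorted l -> noncomplementary l ->
  eval (alternates b) (faces l) = alternates b l (+) alternates (~~ b) l.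
Proof.
rewrite /idx_sorted; elim: l b => [|x l IHl] b; first by rewrite eval_nil.
move=> /andP[xl sl] nl; rewrite eval_faces_cons.
have nl' : noncomplementary l by move=> y z yl zl; apply: nl; rewrite inE (yl, zl) orbT.
have {}IHl c := IHl c sl nl'.
have [lt_xl|] := boolP (all (fun y => x.1 < y.1) l).
  rewrite (@eq_eval _ _ (fun t => (x.2 == b) && alternates (~~ b) t)); last first.
    move=> t tl /=; suff -> : all (fun y => x.1 < y.1) t by [].
    by apply/allP => y /(mem_faces tl)/(allP lt_xl).
  rewrite /= lt_xl /=; case: eqVneq => [->|].
    rewrite IHl; case: (b); case: alternates => //=; case: alternates => //.
  by case: (x.2); case: (b) => // _; rewrite eval_pred0 addbF.
move=> nlt_xl.
have alts_xl c : alternates c (x :: l) = false by rewrite /= (negPf nlt_xl) andbF.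
rewrite !alts_xl.
case: l => // y l in xl sl nl nl' IHl nlt_xl alts_xl *.
move: (xl) (sl) => /= /andP[xy _] /andP[yl _].
(* the list is sorted, so a repeated index is repeated in adjacent positions *)
have eq_yx : y = x.
  have /allPn[z zl] := nlt_xl; rewrite -leqNgt => zx.
  have yx : y.1 <= x.1.
    by move: zl zx; rewrite inE => /predU1P[-> //|/(allP yl)]; apply: leq_trans.
  have xy1 : y.1 = x.1 by apply/eqP; rewrite eqn_leq yx.
  have xy2 : y.2 = x.2 by apply: nl; rewrite ?inE ?eqxx ?orbT.
  by case: (x) (y) xy1 xy2 => a1 a2 [b1 b2] /= -> ->.
rewrite eq_yx in alts_xl *; rewrite eval_faces_cons (@eq_eval _ _ (fun=> false)).
  by rewrite eval_pred0 addbF addbb.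
by move=> t _ /=; rewrite ltnn andbF.
Qed.

Lemma noncomplementary_perm l1 l2 :
  perm_eq l1 l2 -> noncomplementary l1 -> noncomplementary l2.
Proof. by move=> /perm_mem eq_l nl x y; rewrite -!eq_l; apply: nl. Qed.

Lemma isort_opp l :
  isort [seq opp_label x | x <- l] = [seq opp_label x | x <- isort l].
Proof.
elim: l => //= x l ->; elim: (isort l) => //= y l' IHl.
by case: ifP => // _; rewrite IHl.
Qed.

Lemma alternates_opp b l :
  alternates b [seq opp_label x | x <- l] = alternates (~~ b) l.
Proof.
elim: l b => //= x l IHl b; rewrite IHl all_map; congr (_ && _).
by case: (x.2); case: b.
Qed.

(** The coboundary of the alternating count is the count plus its antipode: this
    is the combinatorial core of the Tucker and Ky Fan lemmas.  On a single label
    it says that exactly one of [x] and its opposite is positive. *)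
Lemma eval_faces_alternating l : noncomplementary l ->
  eval alternating (faces l)
    = alternating l (+) alternating [seq opp_label x | x <- l].
Proof.
move=> nl; rewrite eval_faces_isort eval_faces_alternates ?isort_sorted //.
  by rewrite /alternating isort_opp alternates_opp.
by apply: noncomplementary_perm nl; rewrite perm_sym isort_perm.
Qed.

Lemma alternates_uniq b l : alternates b l -> uniq (map fst l).
Proof.
elim: l b => //= x l IHl b /and3P[_ /allP xl /IHl ->]; rewrite andbT.
by apply/mapP => -[y /xl xy eq_xy]; rewrite eq_xy ltnn in xy.
Qed.

Lemma alternating_overflow d l :
  {in l, forall x, x.1 < d} -> d < size l -> alternating l = false.
Proof.
move=> ltd lt_dl; apply/negP => /alternates_uniq uniq_l.
have: size (map fst (isort l)) <= size (iota 0 d).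
  apply: uniq_leq_size => // i /mapP[x].
  by rewrite (perm_mem (isort_perm l)) mem_iota => /ltd lt_xd ->.
by rewrite size_map (perm_size (isort_perm l)) size_iota leqNgt lt_dl.
Qed.

End Alternating.

(** * The Tucker lemma on subdivided cross-polytopes *)
Section Tucker.
Variables (T : eqType) (apex : seq T -> T) (opp : T -> T) (e : nat -> T).
Hypothesis oppK : involutive opp.
Hypothesis apex_opp : forall s, s != [::] -> apex (map opp s) = opp (apex s).

Definition antipode (c : seq (seq T)) := [seq map opp s | s <- c].

(** The boundary of the cross-polytope with vertices [e 0, ..., e (k - 1)] and
    their opposites: an upper hemisphere, which is the cone over the previous
    sphere, and its antipode. *)
Fixpoint sphere k : seq (seq T) :=
  if k is k'.+1 then
    cone (e k') (sphere k') ++ antipode (cone (e k') (sphere k'))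
  else [:: [::]].

Lemma antipodeK c : antipode (antipode c) = c.
Proof.
by rewrite /antipode -map_comp map_id_in // => s _ /=; apply: mapK.
Qed.

Lemma eval_antipode_sphere k phi :
  eval phi (antipode (sphere k)) = eval phi (sphere k).
Proof.
case: k => //= k; rewrite /antipode map_cat -!/(antipode _) antipodeK.
by rewrite !eval_cat addbC.
Qed.

Lemma boundary_antipode c : boundary (antipode c) = antipode (boundary c).
Proof.
rewrite /boundary /antipode map_flatten -!map_comp; congr (flatten _).
by apply: eq_map => s /=; rewrite faces_map.
Qed.

Lemma eval_boundary_sphere k phi : eval phi (boundary (sphere k)) = false.
Proof.
elim: k phi => [|k IHk] phi; first by rewrite /= eval_nil.
rewrite /= /boundary map_cat flatten_cat -!/(boundary _) eval_cat boundary_antipode.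
rewrite [X in _ (+) X]eval_map !eval_boundary_cone !eval_map !IHk !addbF.
by rewrite -[X in _ (+) X]eval_map eval_antipode_sphere addbb.
Qed.

(** Both the upper hemispheres ([x = e k]) and the full ball ([x] the centre)
    are cones of this kind. *)
Lemma eval_boundary_cone_sphere x k phi :
  eval phi (boundary (cone x (sphere k))) = eval phi (sphere k).
Proof. by rewrite eval_boundary_cone eval_map eval_boundary_sphere addbF. Qed.

Lemma size_sphere k s : s \in sphere k -> size s = k.
Proof.
elim: k s => [|k IHk] s /=; first by rewrite inE => /eqP->.
rewrite mem_cat => /orP[/mapP[t /IHk <- ->] // |].
by move=> /mapP[u /mapP[t /IHk <- ->] ->] /=; rewrite size_map.
Qed.

Variables (o : T) (lab : T -> label) (d n : nat).

(** Labels that are odd on the boundary and never opposite on a simplex do not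
    exist when the indices of the labels are less than the dimension [d].  The
    number of alternating simplices of the subdivided sphere is odd for every
    [k <= d]: the two hemispheres together contribute the coboundary count on
    one of them, which is the count on its boundary, the sphere below; the
    induction starts at the empty simplex.  For [k = d] the same computation on
    the ball gives 0. *)
Lemma tucker :
  (forall k s, k < d ->
     s \in iter n (subdiv_chain apex) (cone (e k) (sphere k)) ->
     noncomplementary (map lab s) /\
     {in s, forall x, lab (opp x) = opp_label (lab x)}) ->
  (forall s, s \in iter n (subdiv_chain apex) (cone o (sphere d)) ->
     noncomplementary (map lab s) /\ {in s, forall x, (lab x).1 < d}) ->
  False.
Proof.
move=> bdry_lab ball_lab; pose phi s := alternating (map lab s).
have eval_boundary c : {in c, forall s, noncomplementary (map lab s)} ->
    eval phi (boundary c)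
      = eval phi c (+) eval (fun s => alternating (map opp_label (map lab s))) c.
  move=> nc; rewrite eval_flatten -eval_addb; apply: eq_eval => s cs.
  rewrite -(eval_map alternating (map lab)) -faces_map.
  by rewrite eval_faces_alternating //; apply: nc.
have eval_sphere k : k <= d -> eval phi (iter n (subdiv_chain apex) (sphere k)).
  elim: k => [|k IHk] lt_kd; first by rewrite iter_subdiv_nil eval_cons eval_nil.
  move: (IHk (ltnW lt_kd)).
  rewrite -(eq_eval_iter_subdiv _ _ (fun=> eval_boundary_cone_sphere (e k) _ _)).
  rewrite -eval_boundary_iter_subdiv eval_boundary => [|s /(bdry_lab k s lt_kd)[]//].
  rewrite /= iter_subdiv_cat eval_cat iter_subdiv_map // eval_map.
  congr (is_true (_ (+) _)).
  apply: eq_eval => s /(bdry_lab k s lt_kd)[_ label_opp] /=.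
  rewrite /phi -!map_comp; congr alternating; apply/eq_in_map => x xs /=.
  by rewrite label_opp.
have := eval_sphere d (leqnn d).
rewrite -(eq_eval_iter_subdiv _ _ (fun=> eval_boundary_cone_sphere o _ _)).
rewrite -eval_boundary_iter_subdiv eval_boundary => [|s /ball_lab[]//].
rewrite -eval_addb (@eq_eval _ _ (fun=> false)) ?eval_pred0 // => s cs.
have [_ lt_d] := ball_lab s cs.
have size_s : size s = d.+1.
  have [_ /mapP[t /size_sphere <- ->] ->] := size_iter_subdiv cs.
  by [].
rewrite /phi !(@alternating_overflow d) ?size_map ?size_s // => x /mapP[y].
  by move=> /mapP[z /lt_d ltz ->] ->.
by move=> /lt_d ltz ->.
Qed.

End Tucker.

Import Order.TTheory GRing.Theory Num.Theory.
Import numFieldNormedType.Exports.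
Local Open Scope ring_scope.

(** * The mesh of barycentric subdivisions *)
Section Mesh.
Variables (R : realType) (V : normedModType R).
Implicit Types (s t : seq V) (x y : V).

Definition barycenter s : V := (size s)%:R^-1 *: \sum_(x <- s) x.

Lemma barycenter_opp s : barycenter (map -%R s) = - barycenter s.
Proof. by rewrite /barycenter size_map big_map sumrN scalerN. Qed.

Lemma sum_seq_const (W : zmodType) (w : W) (I : Type) (r : seq I) :
  \sum_(i <- r) w = w *+ size r.
Proof. by rewrite big_const_seq count_predT iter_addr_0. Qed.

Lemma sub_barycenter s x : s != [::] ->
  x - barycenter s = (size s)%:R^-1 *: \sum_(y <- s) (x - y).
Proof.
case: s => // y s _; rewrite sumrB sum_seq_const scalerBr -[x *+ _]scaler_nat.
by rewrite scalerA mulVf ?pnatr_eq0 // scale1r.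
Qed.

Lemma norm_sub_barycenter x s : s != [::] ->
  `|x - barycenter s| <= (size s)%:R^-1 * \sum_(y <- s) `|x - y|.
Proof.
move=> s0; rewrite sub_barycenter // normrZ ger0_norm ?invr_ge0 ?ler0n //.
by rewrite ler_wpM2l ?invr_ge0 ?ler0n // ler_norm_sum.
Qed.

Lemma barycenter_ball x r s : s != [::] ->
  {in s, forall y, `|x - y| <= r} -> `|x - barycenter s| <= r.
Proof.
move=> s0 xs; apply: le_trans (norm_sub_barycenter x s0) _.
rewrite mulrC ler_pdivrMr ?ltr0n ?lt0n ?size_eq0 //.
rewrite mulr_natr -sum_seq_const.
by rewrite big_seq [leRHS]big_seq; apply: ler_sum => y; apply: xs.
Qed.

Definition diam_le s (r : R) := {in s &, forall x y, `|x - y| <= r}.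

Lemma barycenter_vertex s r x : x \in s -> diam_le s r ->
  `|x - barycenter s| <= (size s).-1%:R / (size s)%:R * r.
Proof.
move=> xs Ds; have s0 : s != [::] by case: (s) xs.
apply: le_trans (norm_sub_barycenter x s0) _.
rewrite -mulrA mulrCA ler_wpM2l ?invr_ge0 ?ler0n //.
rewrite (perm_big _ (perm_to_rem xs)) big_cons subrr normr0 /= add0r.
rewrite mulr_natl -(size_rem xs) -sum_seq_const.
rewrite big_seq [leRHS]big_seq; apply: ler_sum => y ys.
by apply: Ds => //; apply: mem_rem ys.
Qed.

(** For a simplex with [m + 1] vertices the diameter shrinks by the factor
    [m / (m + 1)].  That factor bounds the distance from the barycentre to the
    vertices, hence to all points of the closed hull; the other edges lie in
    subdivided proper faces, where the factor is smaller by induction. *)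
Lemma diam_subdivide s t r : diam_le s r -> t \in subdivide barycenter s ->
  diam_le t ((size s).-1%:R / (size s)%:R * r).
Proof.
elim/faces_ind: s r t => [|[|z s] // _ IHs] r t Ds.
  by rewrite subdivide_nil inE => /eqP-> x.
have r0 : 0 <= r by have := Ds z z (mem_head _ _) (mem_head _ _); apply: le_trans.
set q : R := _ * r.
have q0 : 0 <= q by rewrite mulr_ge0 // divr_ge0 ?ler0n.
rewrite subdivide_cons => /mapP[u /mem_subdiv_chain[f fs uf] ->].
have bq y : y \in u -> `|barycenter (z :: s) - y| <= q.
  move: y; apply: (subdivide_hull (Q := fun y => `|barycenter (z :: s) - y| <= q)) uf.
    by move=> v v0; apply: barycenter_ball.
  move=> y yf; rewrite distrC; apply: barycenter_vertex Ds.
  exact: (mem_faces fs).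
have Du : diam_le u q.
  have Df : diam_le f r by move=> x y xf yf; apply: Ds; apply: (mem_faces fs).
  have Du := IHs f fs r u Df uf => x y xu yu; apply: le_trans (Du x y xu yu) _.
  rewrite ler_wpM2r // (size_faces fs) /=.
  have : size f != 0 by rewrite -(size_subdivide uf) size_eq0; case: (u) xu.
  case: (size f) => // k _ /=.
  by rewrite ler_pdivrMr ?ltr0n // mulrAC ler_pdivlMr ?ltr0n // -!natrM ler_nat; nia.
move=> x y; rewrite !inE => /predU1P[->|xu] /predU1P[->|yu].
- by rewrite subrr normr0.
- exact: bq.
- by rewrite distrC; apply: bq.
- exact: Du.
Qed.

Lemma diam_iter_subdiv n m c t r : 0 <= r ->
  {in c, forall s, diam_le s r /\ (size s <= m.+1)%N} ->
  t \in iter n (subdiv_chain barycenter) c ->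
  diam_le t ((m%:R / m.+1%:R) ^+ n * r) /\ (size t <= m.+1)%N.
Proof.
move=> r0 Dc; elim: n t => [|n IHn] t.
  by rewrite mul1r => /Dc.
move=> /mem_subdiv_chain[s /IHn[Ds ms] ts]; rewrite (size_subdivide ts); split => //.
move=> x y xt yt; apply: le_trans (diam_subdivide Ds ts xt yt) _.
rewrite exprS -[leRHS]mulrA ler_wpM2r ?mulr_ge0 ?exprn_ge0 ?divr_ge0 ?ler0n //.
have : size s != 0 by rewrite -(size_subdivide ts) size_eq0; case: (t) xt.
case: (size s) ms => // k km _ /=.
rewrite ler_pdivrMr ?ltr0n // mulrAC ler_pdivlMr ?ltr0n // -!natrM ler_nat; nia.
Qed.

End Mesh.

(** * Zeros of maps that are odd outside a ball *)
Section Modulus.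
Variables (R : realType) (V W : normedModType R).

(** Uniform continuity of [f] relative to its own size.  Compactness is used as
    the near-covering property, with the radius tending to 0 as parameter.
    Around [x] all values stay within [|f x| / 4] of [f x], so that any two of
    them differ by less than [|f x| / 2], while each has norm larger than
    that. *)
Lemma nonvanishing_modulus (K : set V) (f : V -> W) :
    compact K -> continuous f -> (forall x, f x != 0) ->
  exists2 delta, 0 < delta &
    forall x y, K x -> `|x - y| < delta -> `|f x - f y| < `|f x|.
Proof.
move=> cK cf fN0.
pose P (e : R) (x : V) := forall y, `|x - y| < e -> `|f x - f y| < `|f x|.
have := proj1 (compact_near_coveringP _) cK _ (0^'+)%classic P _.
case=> [x Kx|e /= e0 KP].
- have fx4 : 0 < `|f x| / 4 by rewrite divr_gt0 ?normr_gt0.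
  have /nbhs_ballP[e /= e0 fball] : (\forall y \near x, `|f x - f y| < `|f x| / 4)%classic.
    by have /cvgrPdist_lt := cf x; apply.
  have e2 : 0 < e / 2 by rewrite divr_gt0.
  near=> x' t => /= y xy.
  have xx' : `|x - x'| < e / 2.
    by near: x'; apply/nbhs_ballP; exists (e / 2) => //= y; rewrite -ball_normE.
  have te : t < e / 2 by near: t; exact: nbhs_right_lt.
  have fx' : `|f x - f x'| < `|f x| / 4.
    apply: fball; rewrite -ball_normE /=.
    by apply: lt_trans xx' _; lra.
  have fy : `|f x - f y| < `|f x| / 4.
    apply: fball; rewrite -ball_normE /=.
    by have := ler_distD x' x y; lra.
  have := ler_distD (f x) (f x') (f y); have := ler_distD (f x') (f x) 0.
  by rewrite !subr0 [`|f x' - f x|]distrC; lra.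
exists (e / 2); rewrite ?divr_gt0 // => x y Kx.
apply: KP Kx y; rewrite /= ?divr_gt0 //.
rewrite sub0r normrN ger0_norm ?divr_ge0 // ?ltW //.
  by rewrite ltr_pdivrMr //; lra.
Unshelve. all: by end_near.
Qed.
End Modulus.

Section Borsuk.
Variables (R : realType) (d : nat).
Notation V := 'rV[R]_d.+1.
Implicit Types (x y : V) (s : seq V).

Lemma compact_norm_le (r : R) : compact [set x : V | `|x| <= r].
Proof.
apply: bounded_closed_compact.
  by exists r; split; rewrite ?num_real // => M /ltW rM x /= /le_trans; apply.
apply: (@closed_comp _ _ (fun x : V => `|x|) [set t | t <= r]%classic).
  by move=> x _; apply: norm_continuous.
exact: closed_le.
Qed.

Lemma norm_coord_le x i : `|x 0 i| <= `|x|.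
Proof.
rewrite [leRHS]/Num.Def.normr /= mx_normrE.
by apply/bigmax_geP; right => /=; exists (0, i).
Qed.

Lemma norm_coord_max x : exists i, `|x 0 i| = `|x|.
Proof.
have [->|x0] := eqVneq x 0; first by exists 0; rewrite mxE !normr0.
have [|[i j] xij] := @mx_norm_neq0 _ _ _ x; first by rewrite -[mx_norm x]/`|x| normr_eq0.
by exists j; rewrite (ord1 i) in xij; rewrite -xij.
Qed.

Definition vertex (L : R) k : V := L *: delta_mx 0 (inord k).

(** Each simplex of the sphere spans a facet, which lies on a hyperplane
    [\sum_i sg i * x_i = L] with coefficients [sg i] bounded by 1.  This keeps
    the facet away from the origin, also after subdivision.  The second and third
    conclusions are there for the induction on [k]. *)
Lemma sphere_facet (L : R) k s : 0 <= L -> (k <= d.+1)%N ->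
    s \in sphere -%R (vertex L) k ->
  exists sg : 'I_d.+1 -> R,
    [/\ forall i, `|sg i| <= 1, forall i : 'I_d.+1, (k <= i)%N -> sg i = 0,
      {in s, forall x (i : 'I_d.+1), (k <= i)%N -> x 0 i = 0},
      {in s, forall x, \sum_i sg i * x 0 i = L} &
      {in s, forall x, `|x| <= L}].
Proof.
move=> L0; elim: k s => [|k IHk] s lt_kd.
  rewrite inE => /eqP ->; exists (fun=> 0); split=> // i; rewrite ?normr0 //.
rewrite /= mem_cat.
have facet t : t \in cone (vertex L k) (sphere -%R (vertex L) k) ->
  exists sg : 'I_d.+1 -> R,
    [/\ forall i, `|sg i| <= 1, forall i : 'I_d.+1, (k < i)%N -> sg i = 0,
      {in t, forall x (i : 'I_d.+1), (k < i)%N -> x 0 i = 0},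
      {in t, forall x, \sum_i sg i * x 0 i = L} &
      {in t, forall x, `|x| <= L}].
  move=> /mapP[u /(IHk u (ltnW lt_kd))[sg [sg1 sg0 u0 sgu uL]] ->].
  exists (fun i => if i == inord k then 1 else sg i); split.
  - by move=> i; case: ifP; rewrite ?normr1.
  - move=> i ki; case: eqP => [ik|_]; last by rewrite sg0 // ltnW.
    by move: ki; rewrite ik inordK // ltnn.
  - move=> x; rewrite inE => /predU1P[-> i ki|xu i ki]; last by rewrite u0 // ltnW.
    rewrite !mxE eqxx /=; case: eqP => [ik|_]; last by rewrite mulr0.
    by move: ki; rewrite ik inordK // ltnn.
  - move=> x; rewrite inE => /predU1P[->|xu].
      rewrite (bigD1 (inord k)) //= eqxx !mxE !eqxx mul1r mulr1.
      rewrite big1 ?addr0 // => i /negPf ik.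
      by rewrite !mxE ik andbF mulr0 mulr0.
    rewrite -(sgu x xu); apply: eq_bigr => i _; case: eqP => // ->.
    by rewrite u0 ?inordK // ?mulr0.
  - move=> x; rewrite inE => /predU1P[->|/uL//].
    have [i <-] := norm_coord_max (vertex L k).
    rewrite !mxE normrM (ger0_norm L0) ler_piMr //.
    by case: (_ && _); rewrite ?normr1 // normr0.
case/orP => [/facet // | /mapP[t /facet[sg [sg1 sg0 t0 sgt tL]] ->]].
exists (fun i => - sg i); split.
- by move=> i; rewrite normrN.
- by move=> i /sg0->; rewrite oppr0.
- by move=> _ /mapP[x xt ->] i ki; rewrite mxE t0 ?oppr0.
- move=> _ /mapP[x xt ->]; rewrite -(sgt x xt); apply: eq_bigr => i _.
  by rewrite mxE mulrNN.
- by move=> _ /mapP[x xt ->]; rewrite normrN tL.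
Qed.

(** The sign is [true] when the coordinate is negative.  The default value is
    never taken, see [labelP]. *)
Definition lab (f : V -> V) x : label :=
  if [pick i | `|f x 0 i| == `|f x|] is Some i then (i : nat, f x 0 i < 0)
  else (0%N, false).

Lemma labelP f x :
  exists2 i : 'I_d.+1, lab f x = (i : nat, f x 0 i < 0) & `|f x 0 i| = `|f x|.
Proof.
rewrite /lab; case: pickP => [i /eqP|none]; first by exists i.
by have [i /eqP] := norm_coord_max (f x); rewrite none.
Qed.

Lemma label_opp f x :
  f x != 0 -> f (- x) = - f x -> lab f (- x) = opp_label (lab f x).
Proof.
move=> fx0 fNx; have [i _ fxi] := labelP f x; rewrite /lab fNx normrN.
have -> : [pick j | `|(- f x) 0 j| == `|f x|] = [pick j | `|f x 0 j| == `|f x|].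
  by apply: eq_pick => j; rewrite mxE normrN.
case: pickP => [j /eqP fxj|/(_ i)]; last by rewrite fxi eqxx.
rewrite /opp_label /= mxE oppr_lt0; congr (_, _).
have : f x 0 j != 0 by rewrite -normr_eq0 fxj normr_eq0.
by rewrite -leNgt lt_def => ->.
Qed.

Lemma label_idx_lt f x : ((lab f x).1 < d.+1)%N.
Proof. by have [i -> _] := labelP f x; rewrite /= ltn_ord. Qed.

(** If the largest coordinates of [f x] and [f y] had the same index and opposite
    signs, [f x] and [f y] would differ by at least [|f x|] there. *)
Lemma label_noncomplementary f x y : f x != 0 -> `|f x - f y| < `|f x| ->
  (lab f x).1 = (lab f y).1 -> (lab f x).2 = (lab f y).2.
Proof.
move=> fx0; have [i -> fxi] := labelP f x; have [j -> _] := labelP f y => /=.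
move=> fxy /val_inj eq_ij; rewrite -eq_ij => {j eq_ij}.
have := le_lt_trans (norm_coord_le (f x - f y) i) fxy; rewrite -fxi !mxE.
rewrite -normr_gt0 -fxi normr_gt0 in fx0.
case: (ltrgt0P (f x 0 i)) fx0 => // fi _; rewrite ltr_norml => /andP[h1 h2].
  by apply/esym/negbTE; rewrite -leNgt; lra.
by apply/esym; lra.
Qed.

(** A form of the Borsuk-Ulam theorem.  The cross-polytope has vertices at
    distance [(d + 1) r] from the origin, so that its boundary lies outside the
    open ball of radius [r] for the maximum norm. *)
Theorem odd_at_infinity_zero (f : V -> V) (r : R) :
    0 < r -> continuous f ->
    (forall x, r <= `|x| -> f (- x) = - f x) ->
  exists x, f x = 0.
Proof.
move=> r0 cf odd_f; apply: contrapT => /forallNP fN0.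
have {}fN0 x : f x != 0 by apply/eqP/fN0.
pose L : R := d.+1%:R * r.
have L0 : 0 <= L by rewrite mulr_ge0 ?ler0n ?ltW.
have [delta delta0 fdelta] := nonvanishing_modulus (@compact_norm_le L) cf fN0.
have [n qn] : exists n, (d.+1%:R / d.+2%:R) ^+ n * (2 * L) < delta.
  have q1 : `|d.+1%:R / d.+2%:R : R| < 1.
    by rewrite ger0_norm ?divr_ge0 ?ler0n // ltr_pdivrMr ?ltr0n // mul1r ltr_nat.
  have /cvgrPdist_lt/(_ _ delta0)[n _ /(_ n (leqnn n))] := cvg_geometric (2 * L) q1.
  rewrite /= sub0r normrN mulrC => lt_delta; exists n.
  exact: le_lt_trans (ler_norm _) lt_delta.
have norm_le s (c : seq (seq V)) :
    {in c, forall t, {in t, forall x, `|x| <= L}} ->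
    s \in iter n (subdiv_chain (@barycenter R V)) c -> {in s, forall x, `|x| <= L}.
  move=> cL /iter_subdiv_hull[t /cL tL]; apply=> // u u0 uL.
  by rewrite -normrN -sub0r barycenter_ball // => y yu; rewrite sub0r normrN uL.
have noncompl_lab s c :
    {in c, forall t, {in t, forall x, `|x| <= L} /\ (size t <= d.+2)%N} ->
    s \in iter n (subdiv_chain (@barycenter R V)) c ->
    noncomplementary (map (lab f) s).
  move=> cL cs; have sL : {in s, forall x, `|x| <= L}.
    by apply: norm_le cs => t /cL[].
  have [Ds _] : diam_le s ((d.+1%:R / d.+2%:R) ^+ n * (2 * L)) /\ (size s <= d.+2)%N.
    apply: diam_iter_subdiv cs; first by rewrite mulr_ge0.
    move=> t /cL[tL size_t]; split=> // x y xt yt.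
    by apply: le_trans (ler_normB _ _) _; rewrite mulr_natl mulr2n lerD ?tL.
  move=> _ _ /mapP[x xs ->] /mapP[y ys ->]; apply: label_noncomplementary => //.
  by apply: fdelta; [exact: sL | apply: le_lt_trans (Ds x y xs ys) qn].
apply: (@tucker V (@barycenter R V) -%R (vertex L) _ _ 0 (lab f) d.+1 n).
- exact: opprK.
- by move=> s _; apply: barycenter_opp.
- move=> k s lt_kd cs.
  have cone_sphere : {subset cone (vertex L k) (sphere -%R (vertex L) k)
      <= sphere -%R (vertex L) k.+1} by move=> t ct; rewrite /= mem_cat ct.
  split.
    apply: noncompl_lab cs => t /cone_sphere tS; rewrite (size_sphere tS).
    by have [sg [_ _ _ _ tL]] := sphere_facet L0 lt_kd tS; split=> //; lia.
  move=> x xs; apply: label_opp => //; apply: odd_f.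
  have [t /cone_sphere/(sphere_facet L0 lt_kd) + hull] := iter_subdiv_hull cs.
  move=> [sg [sg1 _ _ sgt _]].
  (* x stays on the hyperplane of the facet it comes from *)
  have sgx : \sum_i sg i * x 0 i = L.
    apply: hull sgt x xs => u u0 sgu.
    rewrite (eq_bigr (fun i => (size u)%:R^-1 * \sum_(y <- u) sg i * y 0 i)).
      rewrite -mulr_sumr exchange_big /= (eq_big_seq (fun=> L)) //.
      by rewrite sum_seq_const -[L *+ _]mulr_natl mulKf // pnatr_eq0 size_eq0.
    by move=> i _; rewrite !mxE summxE -mulr_sumr mulrCA.
  rewrite -(@ler_pM2l _ d.+1%:R) ?ltr0n // -/L -sgx.
  apply: le_trans (ler_norm _) _; apply: le_trans (ler_norm_sum _ _ _) _.
  have -> : d.+1%:R * `|x| = \sum_(i < d.+1) `|x|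
    by rewrite sumr_const card_ord mulr_natl.
  apply: ler_sum => i _.
  by rewrite normrM -[leRHS]mul1r ler_pM ?norm_coord_le.
move=> s cs; split; last by move=> x _; apply: label_idx_lt.
apply: noncompl_lab cs => _ /mapP[t tS ->]; rewrite /= (size_sphere tS); split=> //.
move=> x; rewrite inE => /predU1P[->|xt]; first by rewrite normr0.
by have [sg [_ _ _ _ tL]] := sphere_facet L0 (leqnn _) tS; apply: tL.
Qed.
End Borsuk.

(** * Odd maps perturbed by smaller terms *)
Section Dominated.
Variables (R : realType) (d : nat).
Notation V := 'rV[R]_d.+1.

(** Multiplying [g] by a cut-off function that is 1 on the ball of radius [r] and
    0 outside the ball of radius [r + 1] makes the sum odd far away.  Its zeros
    lie in the smaller ball by domination, where the cut-off is invisible. *)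
Lemma odd_dominated_zero (f g : V -> V) (r : R) :
    0 < r -> continuous f -> continuous g -> (forall x, f (- x) = - f x) ->
    (forall x t, r <= `|x| -> 0 <= t <= 1 -> f x + t *: g x != 0) ->
  exists x, f x + g x = 0.
Proof.
move=> r0 cf cg odd_f dom.
(* the cut-off: 1 for |x| <= r and 0 for |x| >= r + 1 *)
pose chi (x : V) : R := Num.max 0 (Num.min 1 (r + 1 - `|x|)).
have cchi : continuous (chi : V -> R).
  move=> x; apply: (@continuous_max R V (cst 0) (fun x => Num.min 1 (r + 1 - `|x|))).
    exact: cst_continuous.
  apply: (@continuous_min R V (cst 1) (fun x => r + 1 - `|x|)).
    exact: cst_continuous.
  apply: (@cvgB R R^o V (nbhs x) _ (cst (r + 1)) (fun x => `|x|)).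
    exact: cvg_cst.
  exact: norm_continuous.
have [|||x fx] := @odd_at_infinity_zero R d (fun x => f x + chi x *: g x) (r + 1).
- by rewrite addr_gt0.
- move=> x; apply: (@cvgD R V V (nbhs x) _ f (fun x => chi x *: g x)).
    exact: cf.
  by apply: cvgZ; [exact: cchi | exact: cg].
- move=> x rx; have chi0 y : r + 1 <= `|y| -> chi y = 0.
    by move=> ry; apply/max_idPl; rewrite ge_min subr_le0 ry orbT.
  by rewrite !chi0 ?normrN // !scale0r !addr0.
exists x; move: fx; have [rx|xr] := leP r `|x|.
  move/eqP; rewrite (negPf (dom x (chi x) rx _)) //.
  by rewrite le_max lexx /= ge_max ler01 /= ge_min lexx.
suff -> : chi x = 1 by rewrite scale1r.
have -> : chi x = Num.max 0 1 by congr Num.max; apply/min_idPl; lra.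
exact/max_idPr.
Qed.

Lemma continuous_rV (T : topologicalType) (f : T -> V) :
  (forall i, continuous (fun x => f x 0 i)) -> continuous f.
Proof.
move=> cf x; apply/cvgrPdist_lt => e e0; near=> y.
have [i <-] := norm_coord_max (f x - f y); rewrite !mxE; move: i; near: y.
apply: filter_forall => i; have /cvgrPdist_lt := cf i x; exact.
Unshelve. all: by end_near.
Qed.
End Dominated.

(** * Quaternionic polynomial maps *)
Section Quaternions.
Variable R : realType.
Notation H := (quaternion R).
Notation V := 'rV[R]_4.
Implicit Types (x y z : H) (v : V).

Lemma normsqM x y : normsq (x * y) = normsq x * normsq y.
Proof. by case: x y => [? ? ? ?] [? ? ? ?] /=; ring. Qed.

Lemma normsqN x : normsq (- x) = normsq x.
Proof. by case: x => [? ? ? ?] /=; ring. Qed.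

Lemma normsq_ge0 x : 0 <= normsq x.
Proof. by case: x => [? ? ? ?] /=; rewrite !addr_ge0 ?sqr_ge0. Qed.

Lemma normsq0 : normsq (0 : H) = 0.
Proof. by rewrite /= !expr0n /= !addr0. Qed.

Lemma normsq_gt0 x : (0 < normsq x) = (x != 0).
Proof.
rewrite lt_def normsq_ge0 andbT; apply/idP/idP; last exact: normsq_neq0.
by apply: contraNneq => ->; rewrite normsq0.
Qed.

Lemma normsqD x y : normsq (x + y) <= 2 * (normsq x + normsq y).
Proof.
rewrite -subr_ge0; have := normsq_ge0 (x - y); congr (0 <= _).
by case: x y => [? ? ? ?] [? ? ? ?] /=; ring.
Qed.

Definition conjq x : H := let: Quat a b c d := x in Quat a (- b) (- c) (- d).

Lemma conjqN x : conjq (- x) = - conjq x.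
Proof. by case: x. Qed.

Lemma normsq_conj x : normsq (conjq x) = normsq x.
Proof. by case: x => [? ? ? ?] /=; ring. Qed.

Lemma mulq_conj_central x y : (conjq x * x) * y = y * (conjq x * x).
Proof. by case: x y => [? ? ? ?] [? ? ? ?] /=; congr Quat; ring. Qed.

Definition quat_of_row v : H := Quat (v 0 0) (v 0 1) (v 0 2%:R) (v 0 3%:R).

(** The identification of quaternions with [R^4] transports the preceding results,
    which are about row vectors. *)
Definition row_of_quat x : V := \row_i [:: qre x; qi x; qj x; qk x]`_i.

Lemma row_of_quatK : cancel row_of_quat quat_of_row.
Proof. by case=> a b c d; rewrite /quat_of_row !mxE. Qed.

Lemma row_of_quatD x y : row_of_quat (x + y) = row_of_quat x + row_of_quat y.
Proof.
case: x y => [? ? ? ?] [? ? ? ?]; apply/rowP => -[[|[|[|[|i]]]] //] ?;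
by rewrite !mxE.
Qed.

Lemma row_of_quatN x : row_of_quat (- x) = - row_of_quat x.
Proof.
by case: x => [? ? ? ?]; apply/rowP => -[[|[|[|[|i]]]] //] ?; rewrite !mxE.
Qed.

Lemma quat_of_rowN v : quat_of_row (- v) = - quat_of_row v.
Proof. by rewrite /quat_of_row !mxE. Qed.

Lemma row_of_quatZ t x : t *: row_of_quat x = row_of_quat (Quat t 0 0 0 * x).
Proof.
case: x => [? ? ? ?]; apply/rowP => -[[|[|[|[|i]]]] //] ?; rewrite !mxE /=; ring.
Qed.

Lemma row_of_quat0 : row_of_quat 0 = 0.
Proof. by rewrite -(subrr 0) row_of_quatD row_of_quatN subrr. Qed.

Lemma row_of_quat_inj : injective row_of_quat.
Proof. exact: can_inj row_of_quatK. Qed.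

Lemma sqr_norm_le_normsq v : `|v| ^+ 2 <= normsq (quat_of_row v).
Proof.
have [[i i4] <-] := norm_coord_max v; rewrite real_normK ?num_real //=.
have E k (k4 : (k < 4)%N) (j : 'I_4) : j = k :> nat -> v 0 (Ordinal k4) = v 0 j.
  by move=> jk; congr (v _ _); apply: val_inj; exact/esym.
have := (sqr_ge0 (v 0 0), sqr_ge0 (v 0 1), sqr_ge0 (v 0 2%:R), sqr_ge0 (v 0 3%:R)).
case: i i4 => [|[|[|[|i]]]] // i4 [[[s0 s1] s2] s3].
- by rewrite (E _ _ 0) //; lra.
- by rewrite (E _ _ 1) //; lra.
- by rewrite (E _ _ 2%:R) //; lra.
- by rewrite (E _ _ 3%:R) //; lra.
Qed.

Definition quat_continuous (f : V -> H) :=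
  [/\ continuous (fun v => qre (f v)), continuous (fun v => qi (f v)),
      continuous (fun v => qj (f v)) & continuous (fun v => qk (f v))].

(** The growth condition reads [|f v| = O(|v| ^ k)] away from 0, with squared
    norms.  It is closed under sums and products in the way degrees are, hence
    controls polynomial maps through their mere expression. *)
Definition tame k (f : V -> H) :=
  quat_continuous f /\ exists2 C : R, 0 <= C &
    forall v, 1 <= normsq (quat_of_row v) ->
      normsq (f v) <= C * normsq (quat_of_row v) ^+ k.

Lemma continuous_row_of_quat f :
  quat_continuous f -> continuous (fun v => row_of_quat (f v)).
Proof.
move=> [c0 c1 c2 c3]; apply: continuous_rV => -[[|[|[|[|i]]]] // i4].
- rewrite (_ : (fun v => _) = (fun v => qre (f v))) //.
  by apply/funext => v; rewrite mxE.
- rewrite (_ : (fun v => _) = (fun v => qi (f v))) //.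
  by apply/funext => v; rewrite mxE.
- rewrite (_ : (fun v => _) = (fun v => qj (f v))) //.
  by apply/funext => v; rewrite mxE.
- rewrite (_ : (fun v => _) = (fun v => qk (f v))) //.
  by apply/funext => v; rewrite mxE.
Qed.

Lemma tame_cst k z : tame k (fun=> z).
Proof.
split; first by split; apply: cst_continuous.
exists (normsq z); first exact: normsq_ge0.
by move=> v n1; rewrite ler_peMr ?normsq_ge0 // exprn_ege1.
Qed.

Lemma tame_id : tame 1 quat_of_row.
Proof.
split.
  split; [exact: (@coord_continuous R 1 4 0 0) | exact: (@coord_continuous R 1 4 0 1)
  | exact: (@coord_continuous R 1 4 0 2%:R) | exact: (@coord_continuous R 1 4 0 3%:R)].
by exists 1 => // v _; rewrite mul1r expr1.
Qed.

Lemma tame_conj k f : tame k f -> tame k (fun v => conjq (f v)).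
Proof.
move=> [[c0 c1 c2 c3] [C C0 fC]]; split.
  have cN (h : V -> R) : continuous h -> continuous (fun v => - h v).
    by move=> ch v; exact: (@continuousN R R^o V h v (ch v)).
  split.
  - by rewrite (_ : (fun v => _) = (fun v => qre (f v))) //; apply/funext => v; case: (f v).
  - rewrite (_ : (fun v => _) = (fun v => - qi (f v))); first exact: cN.
    by apply/funext => v; case: (f v).
  - rewrite (_ : (fun v => _) = (fun v => - qj (f v))); first exact: cN.
    by apply/funext => v; case: (f v).
  - rewrite (_ : (fun v => _) = (fun v => - qk (f v))); first exact: cN.
    by apply/funext => v; case: (f v).
by exists C => // v; rewrite normsq_conj; apply: fC.
Qed.

Lemma tameD k f g : tame k f -> tame k g -> tame k (fun v => f v + g v).
Proof.
move=> [[f0 f1 f2 f3] [C C0 fC]] [[g0 g1 g2 g3] [D D0 gD]]; split.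
  have cD (h h' : V -> R) : continuous h -> continuous h' ->
      continuous (fun v => h v + h' v).
    by move=> ch ch' v; exact: (@continuousD R R^o V h h' v (ch v) (ch' v)).
  split.
  - rewrite (_ : (fun v => _) = (fun v => qre (f v) + qre (g v))); first exact: cD.
    by apply/funext => v; case: (f v) (g v) => [? ? ? ?] [? ? ? ?].
  - rewrite (_ : (fun v => _) = (fun v => qi (f v) + qi (g v))); first exact: cD.
    by apply/funext => v; case: (f v) (g v) => [? ? ? ?] [? ? ? ?].
  - rewrite (_ : (fun v => _) = (fun v => qj (f v) + qj (g v))); first exact: cD.
    by apply/funext => v; case: (f v) (g v) => [? ? ? ?] [? ? ? ?].
  - rewrite (_ : (fun v => _) = (fun v => qk (f v) + qk (g v))); first exact: cD.
    by apply/funext => v; case: (f v) (g v) => [? ? ? ?] [? ? ? ?].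
exists (2 * (C + D)); first by rewrite mulr_ge0 ?addr_ge0.
move=> v n1; apply: le_trans (normsqD _ _) _; rewrite -mulrA [(C + D) * _]mulrDl.
by rewrite ler_wpM2l // lerD ?fC ?gD.
Qed.

Lemma tameM k l f g : tame k f -> tame l g -> tame (k + l) (fun v => f v * g v).
Proof.
move=> [[f0 f1 f2 f3] [C C0 fC]] [[g0 g1 g2 g3] [D D0 gD]]; split.
  have cP (h1 h2 h3 h4 h1' h2' h3' h4' : V -> R) (s1 s2 s3 : R) :
    continuous h1 -> continuous h2 -> continuous h3 -> continuous h4 ->
    continuous h1' -> continuous h2' -> continuous h3' -> continuous h4' ->
    continuous (fun v => h1 v * h1' v + s1 * (h2 v * h2' v)
                       + s2 * (h3 v * h3' v) + s3 * (h4 v * h4' v)).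
    have cM (h h' : V -> R) : continuous h -> continuous h' ->
        continuous (fun u => h u * h' u).
      by move=> ch ch' v; exact: (@continuousM R V h h' v (ch v) (ch' v)).
    have cZ (a : R) (h : V -> R) : continuous h -> continuous (fun u => a * h u).
      by apply: cM => v; exact: cst_continuous.
    have cD (h h' : V -> R) : continuous h -> continuous h' ->
        continuous (fun u => h u + h' u).
      by move=> ch ch' v; exact: (@continuousD R R^o V h h' v (ch v) (ch' v)).
    move=> c1 c2 c3 c4 c1' c2' c3' c4'.
    exact: (cD _ _ (cD _ _ (cD _ _ (cM _ _ c1 c1') (cZ s1 _ (cM _ _ c2 c2')))
      (cZ s2 _ (cM _ _ c3 c3'))) (cZ s3 _ (cM _ _ c4 c4'))).
  split.
  - rewrite (_ : (fun v => _) = (fun v => qre (f v) * qre (g v) + -1 * (qi (f v) * qi (g v))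
       + -1 * (qj (f v) * qj (g v)) + -1 * (qk (f v) * qk (g v)))); first exact: cP.
    by apply/funext => v; case: (f v) (g v) => [? ? ? ?] [? ? ? ?] /=; ring.
  - rewrite (_ : (fun v => _) = (fun v => qre (f v) * qi (g v) + 1 * (qi (f v) * qre (g v))
       + 1 * (qj (f v) * qk (g v)) + -1 * (qk (f v) * qj (g v)))); first exact: cP.
    by apply/funext => v; case: (f v) (g v) => [? ? ? ?] [? ? ? ?] /=; ring.
  - rewrite (_ : (fun v => _) = (fun v => qre (f v) * qj (g v) + -1 * (qi (f v) * qk (g v))
       + 1 * (qj (f v) * qre (g v)) + 1 * (qk (f v) * qi (g v)))); first exact: cP.
    by apply/funext => v; case: (f v) (g v) => [? ? ? ?] [? ? ? ?] /=; ring.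
  - rewrite (_ : (fun v => _) = (fun v => qre (f v) * qk (g v) + 1 * (qi (f v) * qj (g v))
       + -1 * (qj (f v) * qi (g v)) + 1 * (qk (f v) * qre (g v)))); first exact: cP.
    by apply/funext => v; case: (f v) (g v) => [? ? ? ?] [? ? ? ?] /=; ring.
exists (C * D); first by rewrite mulr_ge0.
by move=> v n1; rewrite normsqM exprD mulrACA ler_pM ?normsq_ge0 ?fC ?gD.
Qed.

(** The top-degree part [f] is odd and its norm is exactly proportional to a
    power of the norm; it dominates a remainder [g] of lower degree outside a ball
    of radius [1 + C / c], where [C] is the growth constant of [g]. *)
Lemma tame_zero k l c (f g : V -> H) : (l < k)%N -> 0 < c ->
    tame k f -> tame l g ->
    (forall v, f (- v) = - f v) ->
    (forall v, normsq (f v) = c * normsq (quat_of_row v) ^+ k) ->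
  exists v, f v + g v = 0.
Proof.
move=> lk c0 [cf _] [cg [C C0 gC]] odd_f nf.
(* beyond this radius the squared norm n satisfies n >= 1 and c n > C *)
pose r := 1 + C / c; have r1 : 1 <= r by rewrite lerDl divr_ge0 // ltW.
have r0 : 0 < r by apply: lt_le_trans r1.
have [||||v t rv /andP[t0 t1]|v fg] :=
  @odd_dominated_zero R 3 (fun v => row_of_quat (f v))
    (fun v => row_of_quat (g v)) r.
- exact: r0.
- exact: continuous_row_of_quat.
- exact: continuous_row_of_quat.
- by move=> v; rewrite odd_f row_of_quatN.
- rewrite row_of_quatZ -row_of_quatD -row_of_quat0 (inj_eq row_of_quat_inj) addr_eq0.
  apply/eqP => /(congr1 (@normsq R)); rewrite normsqN normsqM nf => E.
  set n := normsq (quat_of_row v) in E *.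
  have rn : r <= n.
    apply: le_trans (sqr_norm_le_normsq v); apply: (le_trans rv).
    by rewrite expr2 ler_peMl // (le_trans r1 rv).
  have n1 := le_trans r1 rn.
  have nl : 0 < n ^+ l by rewrite exprn_gt0 // (lt_le_trans r0).
  have : c * n ^+ k <= C * n ^+ l.
    rewrite E; apply: le_trans (gC v n1).
    rewrite ler_piMl ?normsq_ge0 //= !expr0n /= !addr0.
    by rewrite expr_le1.
  rewrite -(subnK (ltnW lk)) exprD mulrA ler_pM2r //.
  apply/negP; rewrite -ltNge; apply: (@lt_le_trans _ _ (c * n)).
    apply: (@lt_le_trans _ _ (c * r)); last by rewrite ler_pM2l.
    by rewrite /r mulrDr mulrCA divff ?gt_eqF // !mulr1 ltrDr.
  rewrite ler_pM2l // -(prednK (_ : 0 < k - l)%N) ?subn_gt0 // exprS.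
  by rewrite ler_peMr ?exprn_ege1 // (le_trans _ n1).
exists v; apply: row_of_quat_inj.
by rewrite row_of_quatD fg row_of_quat0.
Qed.

(** [cubeq x] is [|x|^2 x], written as a product in order to be visibly polynomial.
    This bijection cancels the denominator of [w^-1]: for [w = cubeq x] one has
    [w t w^-1 = x t (conjq x) / |x|^2], and a factor [w] in front is enough to
    make it polynomial. *)
Definition cubeq x : H := x * conjq x * x.

Lemma normsq_cubeq x : normsq (cubeq x) = normsq x ^+ 3.
Proof. by rewrite !normsqM normsq_conj; ring. Qed.

Lemma cubeqN x : cubeq (- x) = - cubeq x.
Proof. by rewrite /cubeq conjqN mulrNN mulrN. Qed.

Lemma tame_cubeq : tame 3 (fun v => cubeq (quat_of_row v)).
Proof.
exact: (tameM (tameM tame_id (tame_conj tame_id)) tame_id).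
Qed.

(** The polynomial form [x s x t (conjq x)] of [w s w t w^-1], where
    [w = cubeq x].  Inverses are avoided by testing it on a multiple [w u]
    of [w]. *)
Lemma cubeq_conj x s t u :
  x * s * x * t * conjq x * (cubeq x * u) = cubeq x * s * cubeq x * t * u.
Proof.
set n := conjq x * x; have nCA y z : y * (n * z) = n * (y * z).
  by rewrite mulrA -mulq_conj_central mulrA.
have nE y : conjq x * (x * y) = n * y by rewrite mulrA.
have -> : cubeq x = x * n by rewrite /cubeq -mulrA.
move: n nCA nE => n nCA nE; rewrite -!mulrA nE.
by rewrite [in LHS](nCA t) [in LHS](nCA x) [in LHS](nCA s) [in LHS](nCA t).
Qed.

(** With [t = s^-1], any nonzero [w] and [y = w^-1 (e0 + e1 w)] turn the second
    equation, multiplied by [w t] on the left, into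
    [- w t w p w + w t (g0 + g1 w - w g2) + (1 + w t w eps w^-1) (e0 + e1 w) = 0].
    For [w = cubeq x] this is the vanishing of a polynomial in [x] with top degree
    9 and remainder of degree 6.  A zero at [x = 0] means [e0 = 0]; then
    [y = - t g0] solves the system with [w = 0]. *)
Lemma quadratic_pair_zero (s p eps e0 e1 g0 g1 g2 : H) :
    s != 0 -> p != 0 ->
  exists w y, w * y = e0 + e1 * w /\
    (g0 + g1 * w - w * g2 - w * p * w) + (s + w * eps) * y = 0.
Proof.
move=> s0 p0; pose t := s^-1.
have t0 : t != 0 by rewrite invr_eq0.
have st : s * t = 1 by rewrite mulrV.
have ts : t * s = 1 by rewrite mulVr.
pose nu := quat_of_row; pose w v := cubeq (nu v).
have tame_w : tame 3 w := tame_cubeq.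
have c0 k z : tame k (fun=> z) := tame_cst k z.
have tame_top : tame 9 (fun v => w v * - t * w v * p * w v).
  exact: (tameM (tameM (tameM (tameM tame_w (c0 0%N _)) tame_w) (c0 0%N _)) tame_w).
have tame_low : tame 6 (fun v => w v * t * (g0 + g1 * w v + w v * - g2)
    + (1 + nu v * t * nu v * eps * conjq (nu v)) * (e0 + e1 * w v)).
  apply: tameD.
    apply: (@tameM 3 3); first exact: (tameM tame_w (c0 0%N _)).
    apply: tameD; last exact: (tameM tame_w (c0 0%N _)).
    by apply: tameD => //; exact: (tameM (c0 0%N _) tame_w).
  apply: (@tameM 3 3); apply: tameD => //; last exact: (tameM (c0 0%N _) tame_w).
  exact: (tameM (tameM (tameM (tameM tame_id (c0 0%N _)) tame_id) (c0 0%N _))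
    (tame_conj tame_id)).
have [||v|v|v] := @tame_zero 9 6 (normsq t * normsq p) _ _ _ _ tame_top tame_low.
- by [].
- by rewrite mulr_gt0 ?normsq_gt0.
- by rewrite /w /nu quat_of_rowN cubeqN !(mulrN, mulNr) !opprK.
- by rewrite /w /cubeq !normsqM normsqN normsq_conj /nu; ring.
(* at w = 0 the equation only says e0 = 0 *)
have [w0|w0] := eqVneq (w v) 0.
  have nu0 : nu v = 0.
    apply/eqP; have := congr1 (@normsq R) w0; rewrite normsq_cubeq normsq0.
    by move/eqP; rewrite expf_eq0 /=; apply: contraTT => /normsq_neq0.
  rewrite w0 nu0 !mul0r !(mulr0, addr0, add0r) mul1r => ->.
  exists 0, (- (t * g0)); split; first by rewrite !(mul0r, mulr0, add0r).
  by rewrite !(mul0r, mulr0, addr0, subr0) mulrN mulrA st mul1r subrr.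
set u := (w v)^-1 * (e0 + e1 * w v).
have wu : w v * u = e0 + e1 * w v by rewrite mulrA mulrV // mul1r.
rewrite -wu mulrDl mul1r cubeq_conj -/(w v) => zero.
exists (w v), u; split=> //.
have wt0 : w v * t != 0.
  by rewrite -normsq_gt0 normsqM mulr_gt0 ?normsq_gt0.
apply: (mulrI (x := w v * t)); first exact: wt0.
have wu' : w v * u = w v * t * (s * u) by rewrite -mulrA (mulrA t) ts mul1r.
rewrite mulr0 -zero wu' !(mulrN, mulNr) mulrDr mulrBr mulrDl [X in _ + X]mulrDr !mulrA.
by rewrite -addrA addrCA.
Qed.

(** The first equation with [x = 1] gives [z = p (l - a - b y)], where
    [p = c^-1].  After this substitution the terms of the second equation
    that contain [y] collect into [(l - gam) y], which is why [gam] is the right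
    origin for [l].  When [s = 0], the vector [(0, 1, - p b)] is an eigenvector for
    [gam]. *)
Lemma pivot_eigenvector (a b c d e f g h k : H) : c != 0 ->
  exists l x y z, (x != 0) || (y != 0) /\
   [/\ a * x + b * y + c * z = l * x, d * x + e * y + f * z = l * y
     & g * x + h * y + k * z = l * z].
Proof.
move=> c0; pose p := c^-1; have cp : c * p = 1 by rewrite mulrV.
have p0 : p != 0 by rewrite invr_eq0.
pose gam := e - f * p * b; pose s := h - (k - gam) * p * b.
have [s0|s0] := eqVneq s 0.
  exists gam, 0, 1, (- (p * b)); split; first by rewrite oner_neq0 orbT.
  rewrite !(mulr0, add0r, mulr1, mulrN); split.
  - by rewrite mulrA cp mul1r subrr.
  - by rewrite mulrA.
  - move/eqP: s0; rewrite /s subr_eq0 => /eqP->.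
    by rewrite mulrBl mulrBl !mulrA addrAC subrr add0r.
have [w [y [wy zero]]] := quadratic_pair_zero (p * b) (d + f * p * (gam - a))
  (f * p) (g + (k - gam) * p * (gam - a)) ((k - gam) * p) (p * (gam - a)) s0 p0.
exists (gam + w), 1, y, (p * (w + (gam - a) - b * y)); rewrite oner_neq0; split=> //.
rewrite !mulr1; split.
- rewrite mulrA cp mul1r; move: (b * y) (gam) (w) => u1 u2 u3.
  by case: (a) u1 u2 u3 => [? ? ? ?] [? ? ? ?] [? ? ? ?] [? ? ? ?]; congr Quat; ring.
- rewrite mulrDl wy; move: (gam - a) => l; rewrite /gam; clear -d e f p b y l w.
  case: d e f p => [? ? ? ?] [? ? ? ?] [? ? ? ?] [? ? ? ?].
  case: b y l w => [? ? ? ?] [? ? ? ?] [? ? ? ?] [? ? ? ?].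
  by congr Quat; ring.
apply/eqP; rewrite -subr_eq0 -zero /s; apply/eqP.
move: (gam - a) => l; move: (gam) (p) => q p'; clear -g h k q p' l b y w.
case: g h k q => [? ? ? ?] [? ? ? ?] [? ? ? ?] [? ? ? ?].
case: p' l => [? ? ? ?] [? ? ? ?].
case: b y w => [? ? ? ?] [? ? ? ?] [? ? ? ?].
by congr Quat; ring.
Qed.

End Quaternions.

(** * Left eigenvalues *)

Lemma left_eigenvalue_col (S : pzRingType) n (A : 'M[S]_n) l (v : 'cV[S]_n) :
  v != 0 -> A *m v = l *: v -> left_eigenvalue A l.
Proof.
move=> v0 Av [B [_ BA]]; case/eqP: v0.
by rewrite -[v]mul1mx -BA -mulmxA mulmxBl Av mul_scalar_mx subrr mulmx0.
Qed.

Lemma left_eigenvalue_row (S : pzRingType) n (A : 'M[S]_n) l (u : 'rV[S]_n) :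
  u != 0 -> u *m (A - l%:M) = 0 -> left_eigenvalue A l.
Proof.
move=> u0 uA [B [AB _]]; case/eqP: u0.
by rewrite -[u]mulmx1 -AB mulmxA uA mul0mx.
Qed.

Lemma ord3_cover (j k : 'I_3) : j != 0 -> k != 0 -> j != k ->
  forall i : 'I_3, [\/ i = 0, i = j | i = k].
Proof.
move=> j0 k0 jk i; have: [|| i == 0, i == j | i == k].
  by case: i j k j0 k0 jk => [[|[|[|?]]] ?] [[|[|[|?]]] ?] [[|[|[|?]]] ?].
by case/or3P => /eqP; [constructor 1 | constructor 2 | constructor 3].
Qed.

Theorem corollary49 (R : realType) (A : 'M[quaternion R]_3) :
  exists lambda : quaternion R, left_eigenvalue A lambda.
Proof.
have pivot (j k : 'I_3) : j != 0 -> k != 0 -> j != k -> A 0 k != 0 ->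
    exists lambda : quaternion R, left_eigenvalue A lambda.
  move=> j0 k0 jk Ak; have cover := ord3_cover j0 k0 jk.
  have [l [x [y [z [xy [e0 ej ek]]]]]] := pivot_eigenvector (A 0 0) (A 0 j)
    (A j 0) (A j j) (A j k) (A k 0) (A k j) (A k k) Ak.
  pose v : 'cV[quaternion R]_3 :=
    \col_i if i == 0 then x else if i == j then y else z.
  have sum3 (F : 'I_3 -> quaternion R) : \sum_i F i = F 0 + F j + F k.
    rewrite (bigD1 0) //= (bigD1 j) //= (bigD1 k) ?k0 ?[k == j]eq_sym //=.
    rewrite big1 ?addr0 ?addrA // => i /andP[/andP[i0 ij] ik].
    by case: (cover i) i0 ij ik => ->; rewrite eqxx.
  have [v0 vj vk] : [/\ v 0 0 = x, v j 0 = y & v k 0 = z].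
    by rewrite !mxE eqxx (negPf j0) (negPf k0) eqxx [k == j]eq_sym (negPf jk).
  exists l; apply: (@left_eigenvalue_col _ _ _ _ v).
    by apply: contraL xy => /eqP vz; rewrite -v0 -vj vz !mxE eqxx.
  apply/colP => i; rewrite !mxE sum3 v0 vj vk.
  case: (cover i) => ->; first by rewrite e0.
    by rewrite (negPf j0) eqxx ej.
  by rewrite (negPf k0) [k == j]eq_sym (negPf jk) ek.
have [A2|/(pivot 1 2%:R)] := eqVneq (A 0 2%:R) 0; last exact.
have [A1|/(pivot 2%:R 1)] := eqVneq (A 0 1) 0; last exact.
exists (A 0 0); apply: (@left_eigenvalue_row _ _ _ _ (delta_mx 0 0)).
  by apply/eqP => /rowP/(_ 0)/eqP; rewrite !mxE !eqxx oner_eq0.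
rewrite -rowE; apply/rowP => j; rewrite !mxE.
by case: (@ord3_cover 1 2%:R isT isT isT j) => ->;
  rewrite ?A1 ?A2 ?mulr1n ?mulr0n ?subrr ?subr0.
Qed.
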